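(* Let $S_n$ be the smallest integer $k\ge 2$ such that some rooted ordered binary tree of size $k$ is not the ordered shape of any clade of $\mathrm{DTCS}(n)$, and let $S_n^u$ be the smallest integer $k\ge 2$ such that some rooted unordered binary tree of size $k$ is not the unordered shape of any clade of $\mathrm{DTCS}(n)$. Then, with high probability as $n\to\infty$, both $$S_n=(1+o(1))\frac{\log n}{\log\log\log n}\qquad\text{and}\qquad S_n^u=(1+o(1))\frac{\log n}{\log\log\log n}.$$
   Context: Binary trees are rooted full binary trees: every internal vertex has exactly two children. The size of a tree is its number of leaves. Ordered trees (plane trees) are trees in which the left and right subtrees of each internal vertex are distinguished; $T=T'$ means identical as rooted ordered trees, and $T\cong T'$ means identical as rooted unordered trees. For $m\ge 2$ let $h_{m-1}=\sum_{j=1}^{m-1}1/j$ and let $q_m$ be the probability distribution on $\{1,\dots,m-1\}$ given by $$q_m(i)=\frac{m}{2h_{m-1}}\,\frac{1}{i(m-i)}.$$ The discrete-time critical beta-splitting tree $\mathrm{DTCS}(n)$ is the random rooted ordered binary tree with $n$ leaves built as follows: split $[n]=\{1,\dots,n\}$ into a left subtree on $\{1,\dots,L_n\}$ and a right subtree on $\{L_n+1,\dots,n\}$, where $L_n$ has distribution $q_n$; then recursively and independently split each interval of size $m\ge2$ into left and right parts according to $q_m$, stopping at intervals of size $m=1$ (the leaves). Leaf labels are disregarded when comparing shapes. A clade (fringe subtree) of a rooted tree is the subtree induced by an internal vertex together with all of its descendants. Its ordered shape is its isomorphism class as a rooted ordered tree, and its unordered shape is its isomorphism class as a rooted unordered tree.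 $\log$ is the natural logarithm. ''With high probability'' means with probability tending to $1$ as $n\to\infty$; the statement $X_n=(1+o(1))f(n)$ with high probability means that for every $\varepsilon>0$, $\mathbb{P}\big((1-\varepsilon)f(n)\le X_n\le(1+\varepsilon)f(n)\big)\to1$. *)

(* Defs.v *)
From HB Require Import structures.
From mathcomp Require Import all_boot all_order all_algebra.
From mathcomp Require Import all_classical all_reals all_analysis.
From mathcomp Require Import ring.
Set Implicit Arguments.
Unset Strict Implicit.
Unset Printing Implicit Defensive.
Import Order.TTheory GRing.Theory Num.Theory.
Local Open Scope ring_scope.

Inductive btree := Leaf | Node (l r : btree).

Fixpoint gentree_of_btree (t : btree) : GenTree.tree unit :=
  match t with
  | Leaf => GenTree.Leaf tt
  | Node l r => GenTree.Node 0 [:: gentree_of_btree l; gentree_of_btree r]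
  end.

Fixpoint btree_of_gentree (g : GenTree.tree unit) : option btree :=
  match g with
  | GenTree.Leaf _ => Some Leaf
  | GenTree.Node _ [:: g1; g2] =>
      if (btree_of_gentree g1, btree_of_gentree g2) is (Some l, Some r)
      then Some (Node l r) else None
  | _ => None
  end.

Lemma gentree_of_btreeK : pcancel gentree_of_btree btree_of_gentree.
Proof. by elim=> //= l -> r ->. Qed.

HB.instance Definition _ := Countable.copy btree (pcan_type gentree_of_btreeK).

Fixpoint leaves (t : btree) : nat :=
  if t is Node l r then (leaves l + leaves r)%N else 1%N.

(* Ordered trees that are equal as unordered ones: an unordered tree is
   represented by any of its plane embeddings, taken up to [uiso]. *)
Fixpoint uiso (s t : btree) : bool :=
  match s, t with
  | Leaf, Leaf => true
  | Node a b, Node c d => (uiso a c && uiso b d) || (uiso a d && uiso b c)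
  | _, _ => false
  end.

(* Fringe subtrees at the internal vertices, with multiplicity. *)
Fixpoint clades (t : btree) : seq btree :=
  if t is Node l r then t :: clades l ++ clades r else [::].

Definition missing (e : rel btree) (t : btree) (k : nat) : bool :=
  (2 <= k)%N && `[< exists s : btree, leaves s = k /\ ~~ has (e s) (clades t) >].

Lemma leaves_gt0 t : (0 < leaves t)%N.
Proof. by elim: t => //= l Hl r _; rewrite addn_gt0 Hl. Qed.

Lemma leaves_uiso s t : uiso s t -> leaves s = leaves t.
Proof.
elim: s t => [|a IHa b IHb] [|c d] //= /orP[] /andP[/IHa -> /IHb ->] //.
by rewrite addnC.
Qed.

Lemma uiso_refl : reflexive uiso.
Proof. by elim=> //= l -> r ->. Qed.

Lemma leaves_clades t c : c \in clades t -> (leaves c <= leaves t)%N.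
Proof.
elim: t => //= l IHl r IHr; rewrite inE mem_cat => /or3P[/eqP -> //|/IHl|/IHr] h.
  exact: leq_trans h (leq_addr _ _).
exact: leq_trans h (leq_addl _ _).
Qed.

Lemma ex_missing_uiso t : exists k, missing uiso t k.
Proof.
exists (leaves t).+1; rewrite /missing ltnS leaves_gt0 /=; apply/asboolP.
exists (Node t Leaf); split; first by rewrite /= addn1.
apply/hasPn => c /leaves_clades ct; apply/negP => /leaves_uiso /= E.
by move: ct; rewrite -E addn1 ltnn.
Qed.

Lemma ex_missing_eq t : exists k, missing eq_op t k.
Proof.
have [k /andP[k2 /asboolP[s [sk /hasPn ns]]]] := ex_missing_uiso t.
exists k; rewrite /missing k2; apply/asboolP; exists s; split=> //.
apply/hasPn => c /ns; apply: contra => /eqP ->; exact: uiso_refl.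
Qed.

Definition S_ord (t : btree) : nat := ex_minn (ex_missing_eq t).
Definition S_unord (t : btree) : nat := ex_minn (ex_missing_uiso t).

(* Finitely supported distributions, as lists of weighted outcomes; an outcome
   may occur several times, its weights then add up. *)
Section FiniteDistributions.
Variable R : realType.

Definition fdist (T : Type) := seq (R * T).

Definition dret (T : Type) (x : T) : fdist T := [:: (1, x)].

Definition dbind (T U : Type) (d : fdist T) (f : T -> fdist U) : fdist U :=
  flatten [seq [seq (x.1 * y.1, y.2) | y <- f x.2] | x <- d].

Definition Pr (T : Type) (d : fdist T) (A : pred T) : R :=
  \sum_(x <- d | A x.2) x.1.

Definition is_fdist (T : Type) (d : fdist T) : Prop :=
  all (fun x => 0 <= x.1) d /\ Pr d xpredT = 1.

Lemma is_fdist_ret (T : Type) (x : T) : is_fdist (dret x).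
Proof. by split; rewrite /= ?ler01 // /Pr big_seq1. Qed.

Lemma Pr_bind (T U : Type) (d : fdist T) (f : T -> fdist U) (A : pred U) :
  Pr (dbind d f) A = \sum_(x <- d) x.1 * Pr (f x.2) A.
Proof.
rewrite /Pr /dbind big_flatten big_map; apply: eq_bigr => x _.
by rewrite big_map big_distrr.
Qed.

Lemma is_fdist_bind (T : Type) (U : eqType) (d : fdist U) (f : U -> fdist T) :
    is_fdist d -> {in unzip2 d, forall x, is_fdist (f x)} ->
  is_fdist (dbind d f).
Proof.
move=> [d0 d1] f01; split; last first.
  rewrite Pr_bind -d1 big_seq [RHS]big_seq; apply: eq_bigr => x xd.
  by have [_ ->] := f01 _ (map_f snd xd); rewrite mulr1.
elim: d d0 f01 {d1} => //= x d IHd /andP[x0 d0] f01; rewrite all_cat IHd //.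
  rewrite andbT all_map; have [+ _] := f01 _ (mem_head _ _).
  by apply: sub_all => y /= y0; rewrite mulr_ge0.
by move=> y yd; apply: f01; rewrite inE yd orbT.
Qed.

Definition harm (n : nat) : R := \sum_(1 <= j < n.+1) j%:R^-1.

Definition q (m i : nat) : R :=
  m%:R / (2 * harm m.-1) * (1 / (i%:R * (m - i)%:R)).

Definition qdist (m : nat) : fdist nat := [seq (q m i, i) | i <- index_iota 1 m].

Lemma is_fdist_q m : (2 <= m)%N -> is_fdist (qdist m).
Proof.
case: m => [|m] // m1; have h0 : 0 < harm m.
  rewrite /harm big_nat_recl //= invr1 ltr_pwDl ?ltr01 //.
  by apply: sumr_ge0 => i _; rewrite invr_ge0.
split.
  rewrite all_map; apply/allP => i _ /=.
  by rewrite /q /= mulr_ge0 ?divr_ge0 ?mulr_ge0 // ltW.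
rewrite /Pr big_map /q -mulr_sumr /=.
have -> : \sum_(1 <= i < m.+1) (1 / (i%:R * (m.+1 - i)%:R) : R)
    = m.+1%:R^-1 * (harm m + harm m).
  have {2}-> : harm m = \sum_(1 <= i < m.+1) (m.+1 - i)%:R^-1.
    by rewrite /harm big_nat_rev; apply: eq_bigr => i _; rewrite add1n subSS.
  rewrite /harm -big_split /= mulr_sumr.
  apply: eq_big_nat => i /andP[i0 im].
  have iN : i%:R != 0 :> R by rewrite pnatr_eq0 -lt0n.
  have miN : (m.+1 - i)%:R != 0 :> R by rewrite pnatr_eq0 subn_eq0 -ltnNge.
  have mN : m.+1%:R != 0 :> R by rewrite pnatr_eq0.
  have E : m.+1%:R = i%:R + (m.+1 - i)%:R :> R by rewrite -natrD subnKC // ltnW.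
  rewrite E in mN *; move: iN miN mN.
  move: i%:R (m.+1 - i)%:R => a b a0 b0 ab0.
  by field; rewrite a0 b0 ab0.
rewrite -mulr2n -[harm m *+ 2]mulr_natl mulrACA mulVf ?mulf_neq0 ?gt_eqF //.
by rewrite mulr1 mulfV // pnatr_eq0.
Qed.

(* [dtcs_rec k m] is the law of the tree built on an interval of size [m], for
   any recursion bound [k >= m - 1]; see [dtcsE]. *)
Fixpoint dtcs_rec (k m : nat) : fdist btree :=
  if k is k'.+1 then
    if (m <= 1)%N then dret Leaf
    else dbind (qdist m) (fun i =>
         dbind (dtcs_rec k' i) (fun l =>
         dbind (dtcs_rec k' (m - i)) (fun r => dret (Node l r))))
  else dret Leaf.

Definition dtcs (n : nat) : fdist btree := dtcs_rec n n.

Lemma eq_in_dbind (T : eqType) (U : Type) (d : fdist T) (f g : T -> fdist U) :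
  {in unzip2 d, f =1 g} -> dbind d f = dbind d g.
Proof.
rewrite /dbind => fg; congr flatten; elim: d fg => //= x d IHd fg.
rewrite fg ?mem_head // IHd // => y yd; apply: fg.
by rewrite inE yd orbT.
Qed.

Lemma unzip2_qdist m : unzip2 (qdist m) = index_iota 1 m.
Proof. by rewrite /unzip2 -map_comp map_id. Qed.

Lemma dtcs_recE k k' m :
  (m <= k.+1)%N -> (m <= k'.+1)%N -> dtcs_rec k m = dtcs_rec k' m.
Proof.
elim: k k' m => [|k IHk] [|k'] m //= mk mk'; rewrite ?mk ?mk' //.
case: ifP => // m1; apply: eq_in_dbind => i.
rewrite unzip2_qdist mem_index_iota => /andP[i0 im].
have ik j : (j < m)%N -> dtcs_rec k j = dtcs_rec k' j.
  by move=> jm; apply: IHk; rewrite -ltnS (leq_trans jm).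
rewrite (ik i) // (ik (m - i)%N) // ltn_subrL i0.
exact: leq_ltn_trans im.
Qed.

Lemma dtcs1 : dtcs 1 = dret Leaf.
Proof. by []. Qed.

Lemma dtcsE n : (2 <= n)%N ->
  dtcs n = dbind (qdist n) (fun i =>
           dbind (dtcs i) (fun l =>
           dbind (dtcs (n - i)) (fun r => dret (Node l r)))).
Proof.
case: n => [|n] // n2; rewrite {1}/dtcs /= leqNgt n2 /=; apply: eq_in_dbind => i.
rewrite unzip2_qdist mem_index_iota => /andP[i0 im].
rewrite (@dtcs_recE n i i) // ?(ltnW im) //.
by rewrite (@dtcs_recE n (n.+1 - i) (n.+1 - i)) // leq_subr.
Qed.

Lemma is_fdist_dtcs n : is_fdist (dtcs n).
Proof.
suff H k m : is_fdist (dtcs_rec k m) by exact: H.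
elim: k m => [|k IHk] m /=; first exact: is_fdist_ret.
case: ifP => [_|/negbT m1]; first exact: is_fdist_ret.
apply: is_fdist_bind => [|i _]; first by apply: is_fdist_q; rewrite ltnNge.
by do 2?[apply: is_fdist_bind => // ? _]; exact: is_fdist_ret.
Qed.

End FiniteDistributions.

(* Main.v *)
Require Import Defs.
From mathcomp Require Import all_boot all_order all_algebra.
From mathcomp Require Import all_classical all_reals all_analysis.
From mathcomp Require Import ring lra zify.
Import Order.TTheory GRing.Theory Num.Theory numFieldNormedType.Exports.
Local Open Scope classical_set_scope.
Local Open Scope ring_scope.
Set Implicit Arguments.
Unset Strict Implicit.

(** A given tree [s] with [k] leaves has probability at least [(2 h_k)^-k] under
    the law of [DTCS(k)], since the factors [m / (i (m - i))] telescope to [k];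
    up to lower order terms in the exponent this is sharp for the caterpillar,
    and [k log log k = log n] gives [k ~ log n / log log log n].

    Upper bound: every clade of size [k] is a copy of [DTCS(k)], and there are
    fewer than [n] of them, so the caterpillar with [(1 + eps) f(n)] leaves has
    a vanishing expected number of copies, even as an unordered tree.

    Lower bound: the probability [F n] that [s] is not a clade of [DTCS(n)]
    satisfies [F n <= \sum_i q_n(i) F(i) F(n - i)] for [n >= 2].  An induction
    with the ansatz [F n <= 1 / (1 + b (n + 32 k))] shows that
    [F n = O(k^3 / (n P(DTCS(k) = s)))], with no second moment.  A union bound
    over the at most [4^j] trees of each size [j < (1 - eps) f(n)] concludes. *)

(** * Elementary probability for finitely supported laws *)

Section Probability.
Variables (R : realType) (T : Type) (d : fdist R T).
Hypothesis dP : is_fdist d.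

Lemma le_Pr (A B : pred T) : (forall x, A x -> B x) -> Pr d A <= Pr d B.
Proof.
move=> AB; case: dP => d0 _; rewrite /Pr.
elim: d d0 => [|x e IHe] /=; first by rewrite !big_nil.
move=> /andP[x0 e0]; rewrite !big_cons; have := IHe e0.
case: ifP => [/AB ->|_]; first by rewrite lerD2l.
by case: ifP => // _ h; rewrite (le_trans h) // lerDr.
Qed.

Lemma Pr_ge0 (A : pred T) : 0 <= Pr d A.
Proof.
have <- : Pr d xpred0 = 0 by rewrite /Pr big_pred0.
exact: le_Pr.
Qed.

Lemma PrT (A : pred T) : (forall x, A x) -> Pr d A = 1.
Proof. by move=> AT; case: dP => _ <-; apply: eq_bigl => x; rewrite AT. Qed.

Lemma Pr_le1 (A : pred T) : Pr d A <= 1.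
Proof. by rewrite -(@PrT xpredT) //; exact: le_Pr. Qed.

Lemma PrC (A : pred T) : Pr d (fun x => ~~ A x) = 1 - Pr d A.
Proof.
case: dP => _ <-; rewrite [Pr d xpredT]/Pr (bigID (fun x => A x.2)) /=.
by rewrite [X in X - _]addrC addrK.
Qed.

Lemma Pr_or (A B : pred T) : Pr d (fun x => A x || B x) <= Pr d A + Pr d B.
Proof.
have -> : Pr d (fun x => A x || B x) = Pr d A + Pr d (fun x => ~~ A x && B x).
  rewrite /Pr (bigID (fun x => A x.2)) /=; congr (_ + _).
    by apply: eq_bigl => x; case: (A x.2); rewrite /= ?andbF.
  by apply: eq_bigl => x; case: (A x.2); rewrite /= ?andbT ?andbF.
by rewrite lerD2l; apply: le_Pr => x /andP[].
Qed.

Lemma Pr_has (I : Type) (s : seq I) (A : I -> pred T) :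
  Pr d (fun x => has (A^~ x) s) <= \sum_(i <- s) Pr d (A i).
Proof.
elim: s => [|i s IHs]; first by rewrite big_nil /Pr big_pred0.
by rewrite big_cons (le_trans (Pr_or _ _)) // lerD2l.
Qed.

End Probability.

Lemma eq_Pr (R : realType) (T : Type) (d : fdist R T) (A B : pred T) :
  A =1 B -> Pr d A = Pr d B.
Proof. by move=> AB; apply: eq_bigl => x; rewrite AB. Qed.

Definition fdist_pair (R : realType) (T U : Type) (d : fdist R T) (e : fdist R U) :=
  dbind d (fun x => dbind e (fun y => dret R (x, y))).

Lemma Pr_dret (R : realType) (T : Type) (x : T) (A : pred T) :
  Pr (dret R x) A = (A x)%:R.
Proof. by rewrite /Pr /dret big_mkcond big_seq1 /=; case: (A x). Qed.

Lemma Pr_map (R : realType) (T U : Type) (d : fdist R T) (f : T -> U)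
    (A : pred U) :
  Pr (dbind d (fun x => dret R (f x))) A = Pr d (fun x => A (f x)).
Proof.
rewrite Pr_bind [RHS]/Pr [RHS]big_mkcond; apply: eq_bigr => x _.
by rewrite Pr_dret; case: (A _); rewrite ?mulr1 ?mulr0.
Qed.

Lemma Pr_pair (R : realType) (T U : Type) (d : fdist R T) (e : fdist R U)
    (A : pred T) (B : pred U) :
  Pr (fdist_pair d e) (fun x => A x.1 && B x.2) = Pr d A * Pr e B.
Proof.
rewrite Pr_bind [Pr d A]/Pr [X in X * _]big_mkcond big_distrl /=; apply: eq_bigr => x _.
rewrite Pr_map /=; case: (A _) => //.
by rewrite /= mul0r /Pr big_pred0 ?mulr0.
Qed.

Lemma is_fdist_pair (R : realType) (T U : eqType) (d : fdist R T) (e : fdist R U) :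
  is_fdist d -> is_fdist e -> is_fdist (fdist_pair d e).
Proof.
move=> dP eP; apply: is_fdist_bind => // x _; apply: is_fdist_bind => // y _.
exact: is_fdist_ret.
Qed.

(** Conditioning on the first split. The two subtrees are packed into one product law, so that
    [Pr_pair] turns their independence given the split into a product. *)
Lemma Pr_dtcs (R : realType) (n : nat) (A : pred btree) : (2 <= n)%N ->
  Pr (dtcs R n) A = \sum_(1 <= i < n) q R n i *
    Pr (fdist_pair (dtcs R i) (dtcs R (n - i))) (fun x => A (Node x.1 x.2)).
Proof.
move=> n2; rewrite dtcsE // Pr_bind /qdist big_map; apply: eq_bigr => i _ /=.
congr (_ * _); rewrite Pr_bind [RHS]Pr_bind; apply: eq_bigr => x _.
by rewrite !Pr_map.
Qed.

(** * Harmonic numbers and the splitting law *)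

Lemma harmS (R : realType) (n : nat) : harm R n.+1 = harm R n + n.+1%:R^-1.
Proof. by rewrite /harm big_nat_recr. Qed.

Lemma harm_le_nat (R : realType) (n : nat) : harm R n <= n%:R.
Proof.
elim: n => [|n IHn]; first by rewrite /harm big_geq.
rewrite harmS [leRHS]mulrSr lerD // invf_le1 ?ltr0n //.
by rewrite (ler_nat R 1).
Qed.

Lemma le_harm (R : realType) (m n : nat) : (m <= n)%N -> harm R m <= harm R n.
Proof.
move=> mn; rewrite -(subnKC mn); elim: (n - m)%N => [|j IHj]; first by rewrite addn0.
by rewrite addnS harmS (le_trans IHj) // lerDl.
Qed.

Lemma harm_ge1 (R : realType) (n : nat) : (0 < n)%N -> 1 <= harm R n.
Proof.
by move=> n0; rewrite (le_trans _ (le_harm R n0)) // /harm big_nat1 invr1.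
Qed.

Lemma q_ge0 (R : realType) (m i : nat) : 0 <= q R m i.
Proof.
by rewrite /q mulr_ge0 ?divr_ge0 ?mulr_ge0 // /harm sumr_ge0.
Qed.

Lemma sum_q (R : realType) (m : nat) : (2 <= m)%N -> \sum_(1 <= i < m) q R m i = 1.
Proof. by move=> /(is_fdist_q R)[_]; rewrite /Pr /qdist big_map. Qed.

Lemma qC (R : realType) (m i : nat) : (i <= m)%N -> q R m (m - i) = q R m i.
Proof. by move=> im; rewrite /q subKn // [_ * (m - i)%:R]mulrC. Qed.

Lemma sum_nat_le_const (R : realType) (a b : nat) (f : nat -> R) (c : R) :
  (forall i, (a <= i < b)%N -> f i <= c) ->
  \sum_(a <= i < b) f i <= (b - a)%:R * c.
Proof.
move=> fc; rewrite mulr_natl -sumr_const_nat.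
by rewrite big_seq [leRHS]big_seq ler_sum // => i; rewrite mem_index_iota => /fc.
Qed.

(** * The recursive inequality for the probability of missing a tree *)

Section SplittingRecursion.
Variables (R : realType) (F : nat -> R) (k : nat) (p : R).
Hypotheses (k0 : (0 < k)%N) (p01 : 0 <= p <= 1).
Hypotheses (F01 : forall n, 0 <= F n <= 1) (Fk : F k <= 1 - p).
Hypothesis FE : forall n, (2 <= n)%N ->
  F n <= \sum_(1 <= i < n) q R n i * (F i * F (n - i)).

Let b : R := p / (288 * k%:R ^+ 3).

Let kR : 1 <= k%:R :> R. Proof. by rewrite (ler_nat R 1). Qed.

Let b0 : 0 <= b.
Proof. case/andP: p01 => p0 _.
exact: divr_ge0 p0 (mulr_ge0 (ler0n _ _) (exprn_ge0 _ (ler0n _ _))). Qed.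

Let k2 : 1 <= k%:R ^+ 2 :> R. Proof. exact: exprn_ege1. Qed.

(** Crude on purpose: [n - k <= n] and [harm R n.-1 <= 4 k] are enough, since a power of [k] is
    negligible in the end. *)
Let qk_lb (n : nat) : (k < n < 4 * k)%N -> (8 * k%:R ^+ 2)^-1 <= q R n k.
Proof.
move=> /andP[kn n4k].
have h0 : 0 < harm R n.-1 by rewrite (lt_le_trans ltr01) // harm_ge1; lia.
have hn : harm R n.-1 <= 4 * k%:R.
  by rewrite (le_trans (harm_le_nat _ _)) // -natrM ler_nat; lia.
have nk0 : 0 < (n - k)%:R :> R by rewrite ltr0n subn_gt0.
have nk : (n - k)%:R <= n%:R :> R by rewrite ler_nat leq_subr.
have k0R : 0 < k%:R :> R by rewrite ltr0n.
rewrite /q mulf_div mulr1 ler_pdivlMr ?mulr_gt0 // mulrC ler_pdivrMr; last first.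
  by rewrite mulr_gt0 ?exprn_gt0.
rewrite [leLHS](_ : _ = (n - k)%:R * (2 * harm R n.-1 * k%:R)); last by ring.
apply: ler_pM => //; first by rewrite !mulr_ge0 // ltW.
by have := ler_wpM2r (ltW k0R) hn; rewrite expr2; nra.
Qed.

(** For [n > k], only the split [i = k] is exploited: it contributes a deficit of at least
    [q R n k * p], and every other product [F i * F (n - i)] is bounded by 1. *)
Let small (n : nat) : (k <= n < 4 * k)%N -> F n <= 1 - p / (8 * k%:R ^+ 2).
Proof.
case/andP: p01 => p0 p1 /andP[]; rewrite leq_eqVlt => /orP[/eqP <- _|kn n4k].
  rewrite (le_trans Fk) // lerD2l lerN2 ler_pdivrMr; last by have := k2; lra.
  by rewrite ler_peMr //; have := k2; lra.
have n2 : (2 <= n)%N by exact: leq_trans kn.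
have kin : k \in index_iota 1 n by rewrite mem_index_iota k0 kn.
apply: le_trans (FE n2) _; rewrite -[X in X - _](sum_q R n2).
rewrite !(bigD1_seq k) ?iota_uniq //= addrAC lerD //.
  have : F k * F (n - k) <= 1 - p.
    case/andP: (F01 (n - k)) => _ F1; case/andP: (F01 k) => F0 _.
    by rewrite (le_trans _ Fk) // ler_piMr.
  move=> /(ler_wpM2l (q_ge0 R n k)) /le_trans; apply.
  rewrite mulrBr mulr1 lerD2l lerN2 [leRHS]mulrC ler_wpM2l //.
  by apply: qk_lb; rewrite kn.
apply: ler_sum => i _; rewrite ler_piMr ?q_ge0 //.
case/andP: (F01 i) => ? ?; case/andP: (F01 (n - i)) => ? ?; exact: mulr_ile1.
Qed.

(** The constant 288 in [b] is [8 * 36]: as [n + 32 k <= 36 k], the increment [z] is at most the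
    deficit [y] of [small], and [1 - y <= 1 / (1 + z)] whenever [0 <= z <= y]. *)
Let base (n : nat) : (k <= n < 4 * k)%N -> F n <= (1 + b * (n%:R + 32 * k%:R))^-1.
Proof.
move=> /[dup] nk /small /le_trans; apply.
case/andP: p01 => p0 p1.
have nkR : n%:R <= 4 * k%:R :> R by rewrite -natrM ler_nat; case/andP: nk => _ /ltnW.
have k0R : 0 < k%:R :> R by rewrite ltr0n.
set y := p / _; set z := b * _.
have y0 : 0 <= y by rewrite divr_ge0 // mulr_ge0 // exprn_ge0.
have z0 : 0 <= z by rewrite mulr_ge0 // addr_ge0 // mulr_ge0.
have zy : z <= y.
  have -> : y = b * (36 * k%:R) by rewrite /y /b; field; rewrite gt_eqF.
  by rewrite /z ler_wpM2l //; lra.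
rewrite -[leRHS]mul1r ler_pdivlMr; last by lra.
by nra.
Qed.

(* Terms that cut off fewer than [k] leaves lose at most [2 b / (h D)] each;
   this is compensated by the [k] terms with [k <= i < 2 k], each of which
   gains [4 b / (h D)] because the constant [32 k] is then counted twice. *)
Lemma splitting_recursion_le (n : nat) : (k <= n)%N ->
  F n <= (1 + b * (n%:R + 32 * k%:R))^-1.
Proof.
clearbody b; elim/ltn_ind: n => n IH kn.
have [n4k|n4k] := ltnP n (4 * k); first by apply: base; rewrite kn n4k.
have k0R : 0 < k%:R :> R by rewrite ltr0n.
set D := 1 + _.
have D1 : 1 <= D by rewrite lerDl mulr_ge0 // addr_ge0 // mulr_ge0.
have D0 : 0 < D by lra.
have n2 : (2 <= n)%N by clear -n4k k0; lia.
have h0 : 0 < harm R n.-1.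
  by rewrite (lt_le_trans ltr01) // harm_ge1 //; clear -n2; lia.
pose c := 2 * b / (harm R n.-1 * D).
have c0 : 0 <= c by rewrite divr_ge0 // mulr_ge0 // ltW.
(* Since the weights [q R n i] sum to 1, the goal [D * F n <= 1] follows once the terms [t i] have a
   nonpositive sum. *)
pose t i := q R n i * (D * (F i * F (n - i)) - 1).
suff : \sum_(1 <= i < n) t i <= 0.
  rewrite /t; under eq_bigr do rewrite mulrBr mulr1.
  rewrite sumrB sum_q // subr_le0 => tD.
  rewrite -[leRHS]mul1r ler_pdivlMr // mulrC (le_trans _ tD) //.
  apply: le_trans (ler_wpM2l (ltW D0) (FE n2)) _.
  by rewrite mulr_sumr ler_sum // => i _; rewrite mulrCA.
have tC i : (1 <= i < n)%N -> t (n - i)%N = t i.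
  by move=> /andP[_ /ltnW im]; rewrite /t qC // subKn // [F _ * F _]mulrC.
(* No induction hypothesis is available for [i < k], so [F i] is bounded by 1. The loss
   [D / E - 1 = b i / E] is linear in [i], which cancels the [1 / i] in [q] and makes the bound
   uniform; [n >= 4 k] gives [D <= 2 E] and [n <= 2 (n - i)]. *)
have edge i : (1 <= i < k)%N -> t i <= c.
  move=> /andP[i0 ik]; have i0R : 0 < i%:R :> R by rewrite ltr0n.
  have ikR : i%:R <= k%:R :> R by rewrite ler_nat ltnW.
  have mE : (n - i)%:R = n%:R - i%:R :> R by rewrite natrB // (leq_trans (ltnW ik)).
  have nkR : 4 * k%:R <= n%:R :> R by rewrite -natrM ler_nat.
  have mn : (n - i < n)%N by clear -i0 ik kn; lia.
  have km : (k <= n - i)%N by clear -n4k ik; lia.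
  have := IH _ mn km; rewrite mE => Fm.
  set E := 1 + _ in Fm.
  have bi : b * i%:R <= b * k%:R by rewrite ler_wpM2l.
  have bk : 0 <= b * k%:R by rewrite mulr_ge0.
  have bn : b * (4 * k%:R) <= b * n%:R by rewrite ler_wpM2l.
  have DE : D <= 2 * E by rewrite /D /E; lra.
  have E0 : 0 < E by lra.
  have H : D * (F i * F (n - i)) - 1 <= 2 * (b * i%:R) / D.
    have : F i * F (n - i) <= E^-1.
      case/andP: (F01 i) => Fi0 Fi1; apply: le_trans Fm; rewrite ler_piMl //.
      by case/andP: (F01 (n - i)).
    move=> /(ler_wpM2l (ltW D0)) H; rewrite lerBlDl (le_trans H) //.
    rewrite ler_pdivrMr // mulrDl mul1r -lerBlDl.
    have -> : D - E = b * i%:R by rewrite /D /E; ring.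
    rewrite (_ : _ / D * E = b * i%:R * (2 * E / D)); last by ring.
    apply: ler_peMr; first by rewrite mulr_ge0 // ltW.
    by rewrite ler_pdivlMr // mul1r.
  apply: le_trans (ler_wpM2l (q_ge0 R n i) H) _.
  have m0 : 0 < n%:R - i%:R :> R by lra.
  have -> : q R n i * (2 * (b * i%:R) / D) = c * (n%:R / (2 * (n%:R - i%:R))).
    by rewrite /q mE /c; field; rewrite !gt_eqF.
  by rewrite ler_piMr // ler_pdivrMr; lra.
have edge' i : (n - k + 1 <= i < n)%N -> t i <= c.
  by move=> ik; rewrite -tC ?edge //; clear -ik kn n4k k0; lia.
(* With [w = 32 b k], the inequality [(1 + x) (1 + y) >= 1 + x + y = D + w] bounds the product by
   [1 / (D + w)], and [D / (D + w) - 1 <= - w / (2 D)] because [w <= D]. *)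
have big2 i : (k <= i)%N -> (i <= n - k)%N ->
    D * (F i * F (n - i)) - 1 <= - (16 * b * k%:R / D).
  move=> ki ik.
  have iln : (i < n)%N by clear -k0 ki ik kn; lia.
  have mn : (n - i < n)%N by clear -k0 ki ik kn; lia.
  have km : (k <= n - i)%N by clear -ik kn; lia.
  have Fi := IH _ iln ki; have Fm := IH _ mn km.
  have x0 : 0 <= b * (i%:R + 32 * k%:R) by rewrite mulr_ge0 // addr_ge0 // mulr_ge0.
  have y0 : 0 <= b * ((n - i)%:R + 32 * k%:R).
    by rewrite mulr_ge0 // addr_ge0 // mulr_ge0.
  have w0 : 0 <= 32 * b * k%:R by rewrite !mulr_ge0.
  have wD : 32 * b * k%:R <= D.
    rewrite /D mulrDr; have : 0 <= b * n%:R by rewrite mulr_ge0.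
    by lra.
  have xy : 1 + b * (i%:R + 32 * k%:R) + b * ((n - i)%:R + 32 * k%:R) =
      D + 32 * b * k%:R.
    by rewrite /D natrB ?(ltnW iln) //; ring.
  have : F i * F (n - i) <= (D + 32 * b * k%:R)^-1.
    case/andP: (F01 i) => Fi0 _; case/andP: (F01 (n - i)) => Fm0 _.
    apply: le_trans (ler_pM Fi0 Fm0 Fi Fm) _.
    rewrite -invfM lef_pV2 ?posrE; last 2 first.
    - by rewrite mulr_gt0 // ltr_pwDl.
    - by rewrite ltr_wpDr.
    rewrite -xy -subr_ge0 (_ : _ - _ = b * (i%:R + 32 * k%:R) *
      (b * ((n - i)%:R + 32 * k%:R))); last by ring.
    exact: mulr_ge0.
  move=> /(ler_wpM2l (ltW D0)) H; rewrite lerBlDl (le_trans H) //.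
  rewrite ler_pdivrMr; last by lra.
  rewrite -subr_ge0 (_ : _ - _ =
    16 * b * k%:R * (D - 32 * b * k%:R) / D); last by field; rewrite gt_eqF.
  by rewrite divr_ge0 ?(ltW D0) // mulr_ge0 //; lra.
(* Here [q R n i >= 1 / (2 h i) >= 1 / (4 h k)] with [h = harm R n.-1], which removes the factor [k]
   from the gain of [big2]. *)
have mid i : (k <= i < 2 * k)%N -> t i <= - (2 * c).
  move=> /andP[ki ik]; rewrite /t.
  have w0 : 0 <= 16 * b * k%:R / D by rewrite divr_ge0 ?(ltW D0) // !mulr_ge0.
  have ink : (i <= n - k)%N by clear -ik n4k; lia.
  apply: le_trans (ler_wpM2l (q_ge0 R n i) (big2 _ ki ink)) _.
  rewrite mulrN lerN2.
  have iR : i%:R <= 2 * k%:R :> R by rewrite -natrM ler_nat ltnW.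
  have i0R : 0 < i%:R :> R by rewrite ltr0n (leq_trans k0).
  have m0 : 0 < (n - i)%:R :> R.
    by rewrite ltr0n (leq_trans k0) // (leq_trans ki) //; clear -ik n4k; lia.
  have mn : (n - i)%:R <= n%:R :> R by rewrite ler_nat leq_subr.
  have -> : 2 * c = (4 * harm R n.-1 * k%:R)^-1 * (16 * b * k%:R / D).
    by rewrite /c; field; rewrite !gt_eqF.
  rewrite ler_wpM2r // /q mulf_div mulr1 ler_pdivlMr ?mulr_gt0 // mulrC.
  rewrite ler_pdivrMr ?mulr_gt0 //.
  rewrite [leLHS](_ : _ = (n - i)%:R * (2 * harm R n.-1 * i%:R)); last by ring.
  apply: ler_pM => //; first by rewrite !mulr_ge0 // ltW.
  by have := ler_wpM2l (ltW h0) iR; lra.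
have mid' i : (2 * k <= i < n - k + 1)%N -> t i <= 0.
  move=> /andP[ki ik]; rewrite /t mulr_ge0_le0 ?q_ge0 //.
  have ki' : (k <= i)%N by clear -ki; lia.
  have ink : (i <= n - k)%N by clear -ik n4k; lia.
  by rewrite (le_trans (big2 _ ki' ink)) // oppr_le0 divr_ge0 ?(ltW D0) // !mulr_ge0.
have k2k : (k <= 2 * k)%N by clear; lia.
have k2n : (2 * k <= n - k + 1)%N by clear -n4k k0; lia.
have nkn : (n - k + 1 <= n)%N by clear -kn k0; lia.
(* Cutting at [k], [2 k] and [n - k + 1] bounds the sum by [(k - 1) c - 2 k c + 0 + (k - 1) c = - 2
   c]. *)
rewrite (big_cat_nat (n := k)) // (big_cat_nat (m := k) k2k (leq_trans k2n nkn)).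
rewrite (big_cat_nat (m := (2 * k)%N) k2n nkn).
have := sum_nat_le_const edge.
have := sum_nat_le_const edge'.
have := sum_nat_le_const mid.
have := sum_nat_le_const mid'.
have -> : (n - (n - k + 1) = k - 1)%N by clear -kn k0; lia.
have -> : (2 * k - k = k)%N by clear; lia.
rewrite mulr0 natrB //= => ? ? ? ?.
by have : 0 <= k%:R * c; [rewrite mulr_ge0|lra].
Qed.
End SplittingRecursion.

(** * Counting trees through their preorder words *)

Fixpoint preorder (t : btree) : seq bool :=
  if t is Node l r then true :: preorder l ++ preorder r else [:: false].

(** One step of a stack decoder that reads the word from right to left, so that the left child is on
    top. An internal-vertex bit that finds fewer than two trees is ignored, which keeps decoding
    total. *)
Definition push_bit (b : bool) (s : seq btree) : seq btree :=
  if b then (if s is l :: r :: s' then Node l r :: s' else s) else Leaf :: s.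

Lemma preorderK (t : btree) (s : seq bool) :
  foldr push_bit [::] (preorder t ++ s) = t :: foldr push_bit [::] s.
Proof. by elim: t s => //= l IHl r IHr s; rewrite -catA IHl IHr. Qed.

Lemma size_preorder (t : btree) : size (preorder t) = (2 * leaves t).-1.
Proof.
elim: t => //= l IHl r IHr; rewrite size_cat IHl IHr.
by have := leaves_gt0 l; have := leaves_gt0 r; lia.
Qed.

(** Ill-formed words also decode to some tree, so the list may contain trees of other sizes; it
    serves as a superset of bounded length. *)
Definition trees (k : nat) : seq btree :=
  [seq head Leaf (foldr push_bit [::] (val b)) | b : (2 * k).-1.-tuple bool].

Lemma mem_trees (t : btree) : t \in trees (leaves t).
Proof.
have tP : size (preorder t) == (2 * leaves t).-1 by rewrite size_preorder.
by apply/codomP; exists (Tuple tP); rewrite /= -[preorder t]cats0 preorderK.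
Qed.

Lemma size_trees (k : nat) : (size (trees k) <= 4 ^ k)%N.
Proof.
rewrite size_image card_tuple card_bool (_ : 4 = 2 ^ 2)%N // -expnM.
by rewrite leq_exp2l // leq_pred.
Qed.

(** * Probability that a fixed ordered tree is missed *)

(** A single bound [H] for all harmonic numbers makes the induction uniform. The split into [a] and
    [b] leaves has probability at least [(a + b) / (2 H a b)]; the prefactors [a] and [b] of the
    subtrees cancel, leaving [a + b] and one more power of [1 / (2 H)]. *)
Lemma Pr_eq_ge (R : realType) (t : btree) (H : R) : harm R (leaves t) <= H ->
  (leaves t)%:R * (2 * H)^-1 ^+ (leaves t).-1 <= Pr (dtcs R (leaves t)) (pred1 t).
Proof.
elim: t => [|l IHl r IHr] hH; first by rewrite /= mulr1 dtcs1 Pr_dret.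
have H1 : 1 <= H by rewrite (le_trans _ hH) // harm_ge1 // leaves_gt0.
move: hH => /=; move: (leaves_gt0 l) (leaves_gt0 r) IHl IHr.
case: (leaves l) => // a; case: (leaves r) => // b _ _ IHl IHr hH.
have {}IHl := IHl (le_trans (le_harm R (leq_addr b.+1 a.+1)) hH).
have {}IHr := IHr (le_trans (le_harm R (leq_addl a.+1 b.+1)) hH).
have n2 : (2 <= a.+1 + b.+1)%N by rewrite addnS addSn.
have ain : a.+1 \in index_iota 1 (a.+1 + b.+1).
  by rewrite mem_index_iota /= -addSnnS leq_addr.
rewrite Pr_dtcs // (bigD1_seq a.+1) ?iota_uniq //=.
apply: le_trans (_ : q R (a.+1 + b.+1) a.+1 *
  (Pr (dtcs R a.+1) (pred1 l) * Pr (dtcs R b.+1) (pred1 r)) <= _); last first.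
  rewrite addKn -Pr_pair ler_wpDr //; last first.
    rewrite ler_wpM2l ?q_ge0 // le_Pr //.
      by apply: is_fdist_pair; exact: is_fdist_dtcs.
    by move=> x /= /andP[/eqP -> /eqP ->].
  apply: sumr_ge0 => i _; rewrite mulr_ge0 ?q_ge0 // Pr_ge0 //.
  by apply: is_fdist_pair; exact: is_fdist_dtcs.
set x := (2 * H)^-1 in IHl IHr *.
have x0 : 0 <= x by rewrite invr_ge0; lra.
have a0 : 0 < a.+1%:R :> R by rewrite ltr0n.
have b0 : 0 < b.+1%:R :> R by rewrite ltr0n.
have h1 : 1 <= harm R (a.+1 + b.+1).-1 by rewrite harm_ge1 // addnS.
have hn : harm R (a.+1 + b.+1).-1 <= H by rewrite (le_trans _ hH) // le_harm // leq_pred.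
have qx : (a.+1 + b.+1)%:R * x / (a.+1%:R * b.+1%:R) <= q R (a.+1 + b.+1) a.+1.
  rewrite /q addKn mul1r ler_wpM2r // ?invr_ge0 ?mulr_ge0 //.
  rewrite ler_wpM2l // lef_pV2 ?posrE; lra.
have lr0 : 0 <= a.+1%:R * x ^+ a * (b.+1%:R * x ^+ b).
  by rewrite !mulr_ge0 // exprn_ge0.
apply: le_trans (ler_pM _ lr0 qx (ler_pM _ _ IHl IHr)).
- rewrite addSn /= addnS exprS exprD le_eqVlt; apply/orP; left; apply/eqP.
  by field; rewrite !gt_eqF.
- by rewrite divr_ge0 ?mulr_ge0.
- by rewrite mulr_ge0 // exprn_ge0.
- by rewrite mulr_ge0 // exprn_ge0.
Qed.

(** An instance of [splitting_recursion_le]: a tree avoiding [t] has both subtrees avoiding [t], and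
    these are independent given the split. The resulting [1 / p] is then bounded through
    [Pr_eq_ge]. *)
Lemma Pr_notin_clades_le (R : realType) (t : btree) (n : nat) :
    (2 <= leaves t)%N -> (0 < n)%N ->
  Pr (dtcs R n) (fun u => t \notin clades u) <=
  288 * (leaves t)%:R ^+ 3 * (2 * harm R (leaves t)) ^+ leaves t / n%:R.
Proof.
move=> t2 n0; set k := leaves t in t2 *.
have dP m := is_fdist_dtcs R m.
pose p := Pr (dtcs R k) (pred1 t).
have k0 : (0 < k)%N by exact: ltnW.
have k0R : 0 < k%:R :> R by rewrite ltr0n.
have n0R : 0 < n%:R :> R by rewrite ltr0n.
have h1 : 1 <= harm R k by exact: harm_ge1.
pose H := 2 * harm R k.
have H1 : 1 <= H by rewrite /H; lra.
have H0 : 0 < H by lra.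
have pH : H^-1 ^+ k <= p.
  apply: le_trans (Pr_eq_ge (lexx (harm R k))); rewrite -/H -/k.
  have -> : H^-1 ^+ k = H^-1 * H^-1 ^+ k.-1 by rewrite -exprS prednK.
  rewrite ler_wpM2r ?exprn_ge0 ?invr_ge0 ?(ltW H0) //.
  by rewrite (le_trans (_ : _ <= 1)) ?invf_le1 // (ler_nat R 1).
have p0 : 0 < p by rewrite (lt_le_trans _ pH) // exprn_gt0 // invr_gt0.
have N0 : 0 < 288 :> R by rewrite ltr0n.
have N1 : 1 <= 288 :> R by rewrite (ler_nat R 1).
have rec := @splitting_recursion_le R.
move: (288 : R) N0 N1 rec => N N0 N1 rec.
have Nk : 0 < N * k%:R ^+ 3 by rewrite mulr_gt0 // exprn_gt0.
apply: le_trans (_ : N * k%:R ^+ 3 * p^-1 / n%:R <= _); last first.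
  rewrite ler_wpM2r ?invr_ge0 ?(ltW n0R) // ler_wpM2l ?(ltW Nk) //.
  by rewrite -/H -[H ^+ k]invrK lef_pV2 ?posrE ?invr_gt0 ?exprn_gt0 // -exprVn.
(* For [n < k] the recursion says nothing, but the claimed bound already exceeds 1 since [p <= 1]
   and [n < k]. *)
have [kn|nk] := leqP k n; last first.
  rewrite (le_trans (Pr_le1 (dP n) _)) // ler_pdivlMr // mul1r ler_pdivlMr //.
  have p1 : p <= 1 := Pr_le1 (dP k) _.
  have nkR : n%:R <= k%:R :> R by rewrite ler_nat ltnW.
  have k1 : 1 <= k%:R :> R by rewrite (ler_nat R 1).
  apply: le_trans (_ : k%:R * 1 <= _); first by rewrite ler_pM // ltW.
  rewrite mulr1 exprS mulrCA ler_peMr ?(ltW k0R) //.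
  by rewrite mulr_ege1 // exprn_ege1.
apply: le_trans (rec (fun m => Pr (dtcs R m) (fun u => t \notin clades u))
  k p k0 _ _ _ _ n kn) _.
- by rewrite Pr_le1 // ltW.
- by move=> m; rewrite Pr_ge0 ?Pr_le1.
- rewrite /p -PrC // le_Pr // => u; apply: contraNN => /eqP ->.
  by move: t2; rewrite /k; case: (t) => //= ? ? _; rewrite inE eqxx.
- move=> m m2; rewrite Pr_dtcs //; apply: ler_sum => i _.
  rewrite ler_wpM2l ?q_ge0 // -Pr_pair le_Pr //.
    by apply: is_fdist_pair.
  by move=> x /=; rewrite inE mem_cat !negb_or => /and3P[_ -> ->].
have b0 : 0 < p / (N * k%:R ^+ 3) by rewrite divr_gt0.
rewrite -[leRHS]invrK lef_pV2 ?posrE; last 2 first.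
- by rewrite ltr_pwDl // mulr_ge0 ?(ltW b0) // addr_ge0 // mulr_ge0.
- by rewrite invr_gt0 divr_gt0 // divr_gt0.
rewrite (_ : _^-1 = p / (N * k%:R ^+ 3) * n%:R); last first.
  by field; rewrite !gt_eqF.
rewrite mulrDr addrCA lerDl addr_ge0 // mulr_ge0 ?(ltW b0) // mulr_ge0 //.
Qed.

(** * Occurrences of an unordered tree, and the caterpillar *)

Lemma Pr_pair1 (R : realType) (T U : Type) (d : fdist R T) (e : fdist R U)
    (A : pred T) :
  is_fdist e -> Pr (fdist_pair d e) (fun x => A x.1) = Pr d A.
Proof.
move=> eP; rewrite -[RHS]mulr1 -(PrT eP (A := xpredT)) // -Pr_pair.
by apply: eq_Pr => x; rewrite andbT.
Qed.

Lemma Pr_pair2 (R : realType) (T U : Type) (d : fdist R T) (e : fdist R U)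
    (A : pred U) :
  is_fdist d -> Pr (fdist_pair d e) (fun x => A x.2) = Pr e A.
Proof.
by move=> dP; rewrite -[RHS]mul1r -(PrT dP (A := xpredT)) // -Pr_pair.
Qed.

Lemma Pr_leaves_neq (R : realType) (n : nat) : (0 < n)%N ->
  Pr (dtcs R n) (fun t => leaves t != n) = 0.
Proof.
elim/ltn_ind: n => n IH n0.
have [n1|n2] := leqP n 1.
  have -> : n = 1%N by lia.
  by rewrite dtcs1 Pr_dret.
apply/eqP; rewrite eq_le Pr_ge0 ?andbT; last exact: is_fdist_dtcs.
rewrite Pr_dtcs // big_seq; apply: sumr_le0 => i; rewrite mem_index_iota => /andP[i0 im].
have [d1 d2] := (is_fdist_dtcs R i, is_fdist_dtcs R (n - i)).
rewrite mulr_ge0_le0 ?q_ge0 //.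
apply: (le_trans (le_Pr (is_fdist_pair d1 d2)
  (B := fun x => (leaves x.1 != i) || (leaves x.2 != n - i)%N) _)).
  move=> x /=; apply: contraR; rewrite negb_or !negbK => /andP[/eqP -> /eqP ->].
  by rewrite subnKC // ltnW.
apply: le_trans (Pr_or (is_fdist_pair d1 d2) _ _) _.
rewrite (Pr_pair1 _ (fun t => leaves t != i) d2).
rewrite (Pr_pair2 (dtcs R (n - i)) (fun t => leaves t != n - i)%N d1).
by rewrite !IH ?addr0 ?subn_gt0 // ltn_subrL i0.
Qed.

Lemma Pr_uiso_neq (R : realType) (s : btree) (n : nat) :
  (0 < n)%N -> n != leaves s -> Pr (dtcs R n) (uiso s) = 0.
Proof.
move=> n0 ns; apply/eqP; rewrite eq_le Pr_ge0 ?andbT; last exact: is_fdist_dtcs.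
rewrite -(Pr_leaves_neq R n0) le_Pr //; first exact: is_fdist_dtcs.
by move=> t /leaves_uiso <-; rewrite eq_sym.
Qed.

Fixpoint caterpillar (n : nat) : btree :=
  if n is n'.+1 then Node Leaf (caterpillar n') else Leaf.

Lemma leaves_caterpillar (n : nat) : leaves (caterpillar n) = n.+1.
Proof. by elim: n => //= n ->. Qed.

Lemma sum_nat_eq (R : pzSemiRingType) (n a : nat) (f : nat -> R) : (1 <= a < n)%N ->
  \sum_(1 <= i < n) f i * (i == a)%:R = f a.
Proof.
move=> an; rewrite (bigD1_seq a) ?iota_uniq ?mem_index_iota //= eqxx mulr1.
by rewrite big1 ?addr0 // => i /negbTE ->; rewrite mulr0.
Qed.

(** Each further level requires cutting off one leaf on either side, which costs [2 * q R n.+2 1 =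
    (n + 2) / ((n + 1) h_(n+1))]; the rational factors telescope. *)
Lemma Pr_uiso_caterpillar (R : realType) (n : nat) :
  Pr (dtcs R n.+1) (uiso (caterpillar n)) <=
  n.+1%:R / \prod_(1 <= j < n.+1) harm R j.
Proof.
elim: n => [|n IHn].
  by rewrite big_geq // divr1 Pr_le1 //; exact: is_fdist_dtcs.
set c := caterpillar n in IHn *; set P := Pr _ _ in IHn.
have P0 : 0 <= P by rewrite Pr_ge0 //; exact: is_fdist_dtcs.
have leafE i : (0 < i)%N -> Pr (dtcs R i) (uiso Leaf) <= (i == 1%N)%:R.
  move=> i0; case: eqVneq => [_|i1]; first by rewrite Pr_le1 //; exact: is_fdist_dtcs.
  by rewrite Pr_uiso_neq.
apply: le_trans (_ : 2 * q R n.+2 1 * P <= _); last first.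
  have h0 j : (0 < j)%N -> 0 < harm R j.
    by move=> j0; rewrite (lt_le_trans ltr01) // harm_ge1.
  have hp : 0 < \prod_(1 <= j < n.+1) harm R j.
    by rewrite big_seq prodr_gt0 // => j; rewrite mem_index_iota => /andP[/h0].
  apply: le_trans (ler_wpM2l _ IHn) _; first by rewrite mulr_ge0 // q_ge0.
  rewrite [X in _ <= _ / X]big_nat_recr //= le_eqVlt; apply/orP; left; apply/eqP.
  have := h0 n.+1 isT; rewrite /q subn1 /= => h1.
  by field; rewrite !gt_eqF // ltr0n.
rewrite Pr_dtcs //.
apply: le_trans (_ : \sum_(1 <= i < n.+2) (q R n.+2 i * (i == 1%N)%:R * P +
   q R n.+2 i * (i == n.+1)%:R * P) <= _); last first.
  rewrite big_split /= -!mulr_suml !sum_nat_eq ?ltnS ?leqnn //.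
  by rewrite -(@qC R n.+2 1) // subn1 -mulrDl -mulr2n mulr_natl.
rewrite big_seq [leRHS]big_seq; apply: ler_sum => i.
rewrite mem_index_iota ltnS => /andP[i0 im].
have [d1 d2] := (is_fdist_dtcs R i, is_fdist_dtcs R (n.+2 - i)).
move: (q R n.+2 i) (q_ge0 R n.+2 i) => z z0.
rewrite -!mulrA -mulrDr ler_wpM2l //.
apply: le_trans (Pr_or (is_fdist_pair d1 d2)
  (fun x => uiso Leaf x.1 && uiso c x.2)
  (fun x => uiso Leaf x.2 && uiso c x.1)) _; apply: lerD.
  rewrite Pr_pair; apply: le_trans (ler_wpM2r _ (leafE _ i0)) _.
    exact: Pr_ge0.
  by case: eqVneq => [->|_]; rewrite ?mul0r // subn1.
rewrite (@eq_Pr _ _ _ _ (fun x => uiso c x.1 && uiso Leaf x.2)); last first.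
  by move=> x; rewrite andbC.
have ni0 : (0 < n.+2 - i)%N by rewrite subn_gt0.
rewrite Pr_pair mulrC; apply: le_trans (ler_wpM2r _ (leafE _ ni0)) _.
  exact: Pr_ge0.
have -> : (n.+2 - i == 1)%N = (i == n.+1) by apply/eqP/eqP; clear -im; lia.
by case: eqVneq => [->|_]; rewrite ?mul0r.
Qed.

(** First-moment bound by induction: the root is a copy with probability at most [p], and the
    subtrees have [(i - 1) + (n - i - 1) = n - 2] internal vertices for every split [i]. *)
Lemma Pr_has_uiso_le (R : realType) (s : btree) (n : nat) : (0 < n)%N ->
  Pr (dtcs R n) (fun u => has (uiso s) (clades u)) <=
  n.-1%:R * Pr (dtcs R (leaves s)) (uiso s).
Proof.
set p := Pr _ (uiso s); elim/ltn_ind: n => n IH n0.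
have p0 : 0 <= p by rewrite Pr_ge0 //; exact: is_fdist_dtcs.
have [n1|n2] := leqP n 1.
  have -> : n = 1%N by lia.
  by rewrite dtcs1 Pr_dret mul0r.
have pn : Pr (dtcs R n) (uiso s) <= p.
  by have [->|ns] := eqVneq n (leaves s) => //; rewrite Pr_uiso_neq.
have -> : n.-1%:R * p = p + \sum_(1 <= i < n) q R n i * ((n - 2)%:R * p).
  rewrite -mulr_suml sum_q // mul1r -{2}[p]mul1r -mulrDl -(natrD _ 1).
  by congr (_%:R * _); lia.
apply: le_trans (lerD pn (lexx _)).
rewrite !Pr_dtcs // -big_split /= big_seq [leRHS]big_seq.
apply: ler_sum => i; rewrite mem_index_iota => /andP[i0 im].
have [d1 d2] := (is_fdist_dtcs R i, is_fdist_dtcs R (n - i)).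
have d12 := is_fdist_pair d1 d2.
rewrite -mulrDr ler_wpM2l ?q_ge0 //.
rewrite (@eq_Pr _ _ _ _ (fun x => uiso s (Node x.1 x.2) ||
  (has (uiso s) (clades x.1) || has (uiso s) (clades x.2)))); last first.
  by move=> x /=; rewrite has_cat.
apply: le_trans (Pr_or d12 _ _) _; rewrite lerD2l.
apply: le_trans (Pr_or d12 _ _) _.
rewrite (Pr_pair1 _ (fun t => has (uiso s) (clades t)) d2).
rewrite (Pr_pair2 _ (fun t => has (uiso s) (clades t)) d1).
have ni : (n - i < n)%N by rewrite ltn_subrL i0.
have ni0 : (0 < n - i)%N by rewrite subn_gt0.
apply: le_trans (lerD (IH _ im i0) (IH _ ni ni0)) _.
rewrite -mulrDl -natrD ler_wpM2r // ler_nat.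
by clear -im i0; lia.
Qed.

(** * From missing trees to tail bounds for [S_ord] and [S_unord] *)

(** A tree absent up to [uiso] is absent as a plane tree. Hence only the lower tail of [S_ord] and
    the upper tail of [S_unord] have to be estimated. *)
Lemma S_ord_le_unord (t : btree) : (S_ord t <= S_unord t)%N.
Proof.
rewrite /S_ord /S_unord; case: ex_minnP => k _ kmin; case: ex_minnP => j + _.
move=> /andP[j2 /asboolP[s [sj /hasPn ns]]]; apply: kmin.
rewrite /missing j2; apply/asboolP; exists s; split=> //.
by apply/hasPn => c /ns; apply: contra => /eqP <-; exact: uiso_refl.
Qed.

Lemma S_unord_le (s t : btree) : (2 <= leaves s)%N ->
  ~~ has (uiso s) (clades t) -> (S_unord t <= leaves s)%N.
Proof.
move=> s2 st; rewrite /S_unord; case: ex_minnP => k _; apply.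
by rewrite /missing s2; apply/asboolP; exists s.
Qed.

Lemma S_ord_missing (t : btree) : (2 <= S_ord t)%N /\
  exists2 s, leaves s = S_ord t & s \notin clades t.
Proof.
rewrite /S_ord; case: ex_minnP => k /andP[k2 /asboolP[s [sk st]]] _; split=> //.
exists s => //; apply: contra st => st; apply/hasP; exists s => //.
Qed.

Lemma Pr_S_unord_gt (R : realType) (n k : nat) : (0 < n)%N -> (2 <= k)%N ->
  Pr (dtcs R n) (fun t => (k < S_unord t)%N) <=
  n%:R * (k%:R / \prod_(1 <= j < k) harm R j).
Proof.
case: k => // k n0 k2; set c := caterpillar k.
have cE : leaves c = k.+1 by exact: leaves_caterpillar.
apply: le_trans (le_Pr (is_fdist_dtcs R n) (B := fun u => has (uiso c) (clades u)) _) _.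
  move=> t; apply: contraLR => ct; rewrite -leqNgt -cE.
  by apply: S_unord_le; rewrite ?cE.
apply: le_trans (Pr_has_uiso_le R c n0) _; rewrite cE.
apply: ler_pM => //; last exact: Pr_uiso_caterpillar.
  by rewrite Pr_ge0 //; exact: is_fdist_dtcs.
by rewrite ler_nat leq_pred.
Qed.

(** Union bound over sizes and trees; the count [4 ^ j] is absorbed into the power, turning the 2 of
    [Pr_notin_clades_le] into 8. *)
Lemma Pr_S_ord_lt (R : realType) (n N : nat) (x : R) : (0 < n)%N -> x <= N%:R ->
  Pr (dtcs R n) (fun t => (S_ord t)%:R < x) <=
  \sum_(2 <= j < N | j%:R < x)
     288 * j%:R ^+ 3 * (8 * harm R j) ^+ j / n%:R.
Proof.
move=> n0 xN; have dP := is_fdist_dtcs R n.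
pose miss j t := has (fun s => s \notin clades t) [seq s <- trees j | leaves s == j].
apply: le_trans (le_Pr dP
  (B := fun t => has (miss^~ t) [seq j <- index_iota 2 N | j%:R < x]) _) _.
  move=> t tx; have [t2 [s st nst]] := S_ord_missing t.
  apply/hasP; exists (S_ord t).
    by rewrite mem_filter tx mem_index_iota t2 /= -(ltr_nat R) (lt_le_trans tx).
  by apply/hasP; exists s; rewrite // mem_filter -st eqxx mem_trees.
apply: le_trans (Pr_has dP _ _) _; rewrite big_filter.
rewrite big_seq_cond [leRHS]big_seq_cond; apply: ler_sum => j.
rewrite mem_index_iota => /andP[/andP[j2 _] _].
apply: le_trans (Pr_has dP _ _) _.
have N0 : 0 <= 288 :> R by rewrite ler0n.
have bound := fun t => @Pr_notin_clades_le R t n.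
move: (288 : R) N0 bound => C C0 bound.
apply: le_trans (_ : \sum_(s <- [seq s <- trees j | leaves s == j])
  (C * j%:R ^+ 3 * (2 * harm R j) ^+ j / n%:R) <= _).
  rewrite big_seq [leRHS]big_seq; apply: ler_sum => s.
  by rewrite mem_filter => /andP[/eqP sj _]; rewrite -sj bound // sj.
rewrite big_const_seq count_predT iter_addr_0 -[leLHS]mulr_natl.
have h0 : 0 <= harm R j by rewrite (le_trans ler01) // harm_ge1 // ltnW.
apply: le_trans (_ : (4 ^ j)%:R *
    (C * j%:R ^+ 3 * (2 * harm R j) ^+ j / n%:R) <= _).
  rewrite ler_wpM2r //.
    by rewrite divr_ge0 // mulr_ge0 ?exprn_ge0 ?mulr_ge0 ?exprn_ge0.
  by rewrite ler_nat (leq_trans _ (size_trees j)) // size_filter count_size.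
have -> : (8 * harm R j) ^+ j = 4 ^+ j * (2 * harm R j) ^+ j.
  by rewrite -exprMn mulrA -natrM.
rewrite natrX le_eqVlt; apply/orP; left; apply/eqP.
by move: n%:R^-1 ((2 * _) ^+ j) => ? ?; ring.
Qed.

(** * Logarithmic estimates and the two tails *)

Lemma ln_le_harm (R : realType) (n : nat) : ln n.+1%:R <= harm R n.
Proof.
elim: n => [|n IHn]; first by rewrite ln1 /harm big_geq.
rewrite harmS.
have n0 : 0 < n.+1%:R :> R by rewrite ltr0n.
have -> : n.+2%:R = n.+1%:R * (1 + n.+1%:R^-1) :> R.
  by rewrite mulrDr mulr1 divff ?gt_eqF // natr1.
have i0 : 0 < n.+1%:R^-1 :> R by rewrite invr_gt0.
rewrite lnM ?posrE // ?addr_gt0 // lerD // le_ln1Dx //.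
by rewrite (lt_trans _ i0).
Qed.

Lemma harm_le_ln (R : realType) (n : nat) : (0 < n)%N -> harm R n <= 1 + ln n%:R.
Proof.
case: n => // n _; elim: n => [|n IHn].
  by rewrite ln1 addr0 /harm big_nat1 invr1.
rewrite harmS.
have n0 : 0 < n.+2%:R :> R by rewrite ltr0n.
have i1 : n.+2%:R^-1 < 1 :> R by rewrite invf_lt1 // (ltr_nat R 1).
have E : n.+1%:R = n.+2%:R * (1 + - n.+2%:R^-1) :> R.
  by rewrite mulrBr mulr1 divff ?gt_eqF // -[n.+2%:R]natr1 addrK.
have -> : ln n.+2%:R = ln n.+1%:R - ln (1 + - n.+2%:R^-1) :> R.
  by rewrite E lnM ?posrE // ?subr_gt0 // addrK.
have : ln (1 + - n.+2%:R^-1) <= - n.+2%:R^-1 :> R by rewrite le_ln1Dx // ltrN2.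
by move: IHn; move: (n.+2%:R^-1) => u; lra.
Qed.

Lemma expR_le_ln (R : realType) (x y : R) : expR x <= y -> x <= ln y.
Proof.
move=> xy; have y0 : 0 < y := lt_le_trans (expR_gt0 x) xy.
by rewrite -ler_expR lnK.
Qed.

(** [ln] takes the value 0 at nonpositive arguments, so a positive logarithm forces [0 < x]. This
    lets positivity of the innermost estimate unwind the iterated logarithms. *)
Lemma expR_ln_gt0 (R : realType) (x : R) : 0 < ln x -> expR (ln x) = x.
Proof. by move=> x0; rewrite lnK // posrE ltNge; apply/negP => /ln0; lra. Qed.

Lemma expR_ge_pow (R : realType) (x : R) (n : nat) : 0 <= x ->
  x ^+ n.+1 / (n.+1)`!%:R <= expR x.
Proof. by move=> /(expR_ge1Dxn n); apply: le_trans; rewrite lerDr. Qed.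

Lemma lower_tail (R : realType) (n : nat) (eps : R) :
  let L := ln n%:R in let L3 := ln (ln L) in
  0 < eps -> 1 <= L3 -> (1 - eps) * ln 16 <= eps / 2 * L3 ->
  Pr (dtcs R n) (fun t => (S_ord t)%:R < (1 - eps) * (L / L3)) <=
  576 * L ^+ 4 * expR (- (eps / 2 * L)).
Proof.
move=> L L3 e0 L31 He; pose L2 := ln L.
have L2E : expR L3 = L2 := expR_ln_gt0 (lt_le_trans ltr01 L31).
have L20 : 0 < L2 by rewrite -L2E expR_gt0.
have LE : expR L2 = L := expR_ln_gt0 L20.
have L0 : 0 < L by rewrite -LE expR_gt0.
have nE : expR L = n%:R := expR_ln_gt0 L0.
have L2l : L2 = ln L by [].
clearbody L2 L3 L.
have L22 : 2 <= L2 by rewrite -L2E; have := expR_ge1Dx L3; lra.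
have L1 : 3 <= L by rewrite -LE; have := expR_ge1Dx L2; lra.
have n0 : (0 < n)%N by rewrite -(ltr0n R) -nE expR_gt0.
set x := _ * (L / L3).
pose N := (Num.trunc L).+1.
have LN : L <= N%:R := ltW (truncnS_gt L).
have NL : N%:R <= 2 * L.
  have : (Num.trunc L)%:R <= L by rewrite truncn_le; lra.
  by rewrite /N -natr1; lra.
have fL : L / L3 <= L by rewrite ler_pdivrMr ?ler_peMr; lra.
have f0 : 0 <= L / L3 by rewrite divr_ge0; lra.
have xL : x <= L.
  by apply: le_trans fL; rewrite /x ler_piMl //; lra.
apply: le_trans (Pr_S_ord_lt n0 (le_trans xL LN)) _.
have C0 : 0 <= 288 :> R by rewrite ler0n.
have -> : 576 = 2 * 288 :> R by rewrite -natrM.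
move: (288 : R) C0 => C C0.
set B := C * L ^+ 3 * expR (- (eps / 2 * L)).
have B0 : 0 <= B by rewrite /B !mulr_ge0 ?exprn_ge0 ?expR_ge0 //; lra.
apply: le_trans (_ : N%:R * B <= _); last first.
  apply: le_trans (ler_wpM2r B0 NL) _; rewrite le_eqVlt; apply/orP; left.
  by apply/eqP; rewrite /B; ring.
have term j : (2 <= j < N)%N -> j%:R < x ->
    C * j%:R ^+ 3 * (8 * harm R j) ^+ j / n%:R <= B.
  move=> /andP[j2 _] jx.
  have j0 : (0 < j)%N by exact: ltnW.
  have j0R : 0 < j%:R :> R by rewrite ltr0n.
  have jL : j%:R <= L by lra.
  have h0 : 0 <= harm R j by rewrite (le_trans ler01) // harm_ge1.
  have hj : harm R j <= 2 * L2.
    have : ln (j%:R : R) <= L2 by rewrite L2l ler_ln ?posrE.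
    by have := harm_le_ln R j0; lra.
  (* The base is at most [16 L2 = exp (ln 16 + L3)]. Since [j < (1 - eps) L / L3], the [L3] part of
     the exponent is at most [(1 - eps) L], and the hypothesis on [ln 16] bounds the rest by
     [eps / 2 * L]. *)
  have powj : (8 * harm R j) ^+ j <= expR ((1 - eps / 2) * L).
    apply: le_trans (_ : (16 * L2) ^+ j <= _).
      by apply: lerXn2r; rewrite ?nnegrE; lra.
    have ->: 16 * L2 = expR (ln 16 + L3) by rewrite expRD lnK ?posrE ?L2E.
    rewrite -expRM_natl ler_expR.
    have l16 : 0 <= ln (16 : R) by rewrite ln_ge0 // (ler_nat R 1).
    have := ler_wpM2r (_ : 0 <= ln (16 : R) + L3) (ltW jx) => /(_ _)/le_trans; apply.
      by lra.
    rewrite /x -mulrA mulrDr divfK; last by rewrite gt_eqF //; lra.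
    have -> : (1 - eps) * (L / L3 * ln 16 + L) =
      (1 - eps) * ln 16 * (L / L3) + (1 - eps) * L by ring.
    have := ler_wpM2r f0 He; rewrite -[eps / 2 * L3 * _]mulrA [L3 * _]mulrC.
    by rewrite divfK; [lra|rewrite gt_eqF //; lra].
  rewrite -nE -expRN /B -[leLHS]mulrA; apply: ler_pM.
  - by rewrite mulr_ge0 // exprn_ge0 // ltW.
  - by rewrite mulr_ge0 ?expR_ge0 // exprn_ge0 // mulr_ge0.
  - by rewrite ler_wpM2l // lerXn2r ?nnegrE //; lra.
  - apply: le_trans (ler_wpM2r (expR_ge0 _) powj) _.
    by rewrite -expRD ler_expR; lra.
rewrite big_mkcond /=; apply: le_trans (_ : (N - 2)%:R * B <= _).
  apply: sum_nat_le_const => j jN; case: ifP => // jx.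
  exact: term.
by rewrite ler_wpM2r // ler_nat leq_subr.
Qed.

(** Factors below index [m] are only bounded by 1 from below; truncated subtraction covers
    [k <= m]. *)
Lemma prod_harm_ge (R : realType) (c : R) (m k : nat) : 0 <= c ->
  (forall j, (m <= j)%N -> c <= harm R j) -> (0 < m)%N -> (0 < k)%N ->
  c ^+ (k - m) <= \prod_(1 <= j < k) harm R j.
Proof.
move=> c0 ch m0; case: k => // k _.
elim: k => [|k IHk]; first by rewrite big_geq // (_ : 1 - m = 0)%N //; lia.
rewrite big_nat_recr //=; have [mk|km] := leqP m k.+1.
  by rewrite subSn // exprSr ler_pM ?exprn_ge0 ?ch.
have -> : (k.+2 - m = k.+1 - m)%N by lia.
rewrite (le_trans IHk) // ler_peMr ?harm_ge1 //.
by rewrite (le_trans _ IHk) // exprn_ge0.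
Qed.

Lemma upper_tail (R : realType) (n : nat) (eps : R) :
  let L := ln n%:R in let L3 := ln (ln L) in
  0 < eps -> 1 <= L3 -> 4 * (1 + eps) * ln 2 <= eps * L3 -> 32 <= eps * L3 ->
  Pr (dtcs R n) (fun t => (1 + eps) * (L / L3) < (S_unord t)%:R) <=
  (1 + eps) * L * expR (- (eps / 2 * L)).
Proof.
move=> L L3 e0 L31 He2 He32; pose L2 := ln L.
have L2E : expR L3 = L2 := expR_ln_gt0 (lt_le_trans ltr01 L31).
have L20 : 0 < L2 by rewrite -L2E expR_gt0.
have LE : expR L2 = L := expR_ln_gt0 L20.
have L0 : 0 < L by rewrite -LE expR_gt0.
have nE : expR L = n%:R := expR_ln_gt0 L0.
have L2l : L2 = ln L by [].
clearbody L2 L3 L.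
have L22 : 2 <= L2 by rewrite -L2E; have := expR_ge1Dx L3; lra.
have L1 : 3 <= L by rewrite -LE; have := expR_ge1Dx L2; lra.
have n0 : (0 < n)%N by rewrite -(ltr0n R) -nE expR_gt0.
(* This is the square root of [L]: from index about [s] on, harmonic numbers are at least [L2 / 2],
   and discarding the earlier factors costs at most [eps / 4 * L] in the exponent ([sL3]). *)
pose s := expR (L2 / 2).
have ssL : s * s = L by rewrite /s -expRD -splitr.
have L2q : L3 * L3 <= 2 * L2.
  rewrite -L2E; have := @expR_ge_pow R L3 1 (le_trans ler01 L31).
  rewrite (_ : 2`! = 2)%N // ler_pdivrMr ?ltr0n // expr2; lra.
have s1 : 1 + L2 / 2 <= s by exact: expR_ge1Dx.
have L3L2 : 1 + L3 <= L2 by rewrite -L2E expR_ge1Dx.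
have L2L : 1 + L2 <= L by rewrite -LE expR_ge1Dx.
have sL3 : 2 * s * L3 <= eps / 4 * L.
  have H : 32 * L3 <= eps * L3 * L3 by rewrite ler_wpM2r //; lra.
  have H2 : eps * L3 * L3 <= eps * (2 * L2) by rewrite -mulrA ler_wpM2l //; lra.
  have H3 : eps * L2 <= eps * (2 * s) by rewrite ler_wpM2l //; lra.
  have H4 : 8 * L3 <= eps * s by lra.
  rewrite -ssL; have := ler_wpM2l (_ : 0 <= s) H4 => /(_ _); lra.
set x := _ * (L / L3).
have f0 : 0 <= L / L3 by rewrite divr_ge0; lra.
have fL : L / L3 <= L by rewrite ler_pdivrMr ?ler_peMr; lra.
have L3L : 2 * L3 <= L by have := expR_ge1Dx L2; nra.
have f2 : 2 <= L / L3 by rewrite ler_pdivlMr; lra.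
have xf : L / L3 <= x by rewrite /x ler_peMl //; lra.
pose k := Num.trunc x.
have kx : k%:R <= x by rewrite truncn_le; lra.
have xk : x < k.+1%:R := truncnS_gt x.
have k2 : (2 <= k)%N by rewrite /k truncn_ge_nat; lra.
apply: le_trans (le_Pr (is_fdist_dtcs R n) (B := fun t => (k < S_unord t)%N) _) _.
  by move=> t; rewrite -(ltr_nat R); apply: le_lt_trans.
apply: le_trans (Pr_S_unord_gt R n0 k2) _.
pose m := Num.trunc s.
have ms : m%:R <= s by rewrite truncn_le; lra.
have sm : s < m.+1%:R := truncnS_gt s.
have m0 : (0 < m)%N by rewrite /m truncn_gt0; lra.
have l2 : 0 <= ln (2 : R) by rewrite ln_ge0 // (ler_nat R 1).
have l2' : ln (2 : R) <= 1 := le_ln1Dx (lt_trans (ltrN10 R) ltr01).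
have l32 : 0 <= L3 - ln 2 by lra.
have harm_lb j : (m <= j)%N -> L2 / 2 <= harm R j.
  move=> /(le_harm R); apply: le_trans; apply: le_trans (ln_le_harm R m).
  exact/expR_le_ln/ltW.
have L2h : 0 <= L2 / 2 by lra.
have prod_lb : expR ((k%:R - m%:R) * (L3 - ln 2)) <= \prod_(1 <= j < k) harm R j.
  apply: le_trans (prod_harm_ge L2h harm_lb m0 (ltnW k2)).
  have -> : L2 / 2 = expR (L3 - ln 2) by rewrite expRD expRN lnK ?posrE ?L2E.
  rewrite -expRM_natl ler_expR ler_wpM2r //.
  by rewrite lerBlDr -natrD ler_nat; clear; lia.
set P := \prod_(_ <= _ < _) _ in prod_lb *.
have P0 : 0 < P by rewrite (lt_le_trans _ prod_lb) // expR_gt0.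
have kL : k%:R <= (1 + eps) * L.
  by apply: le_trans kx _; rewrite /x ler_wpM2l //; lra.
have PV : P^-1 <= expR (- ((k%:R - m%:R) * (L3 - ln 2))).
  by rewrite expRN lef_pV2 ?posrE ?expR_gt0.
rewrite -nE mulrCA.
apply: le_trans (ler_wpM2r _ kL) _; first by rewrite mulr_ge0 ?expR_ge0 ?invr_ge0 ?ltW.
rewrite ler_wpM2l ?mulr_ge0 //; try lra.
apply: le_trans (ler_wpM2l (expR_ge0 L) PV) _.
rewrite -expRD ler_expR.
(* Budget: [x * L3] gives [(1 + eps) L]; the halving of [L2] ([A3]) and the rounding plus discarded
   factors ([A4], [sL3]) each lose at most [eps / 4 * L]. *)
have km : x - 1 - s <= k%:R - m%:R by move: xk; rewrite -natr1; lra.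
have A1 := ler_wpM2r l32 km.
have A2 : x * L3 = (1 + eps) * L by rewrite /x -mulrA divfK // gt_eqF //; lra.
have A3 : x * ln 2 <= eps / 4 * L.
  have := ler_wpM2r f0 He2; rewrite -[eps * L3 * _]mulrA [L3 * _]mulrC divfK; last first.
    by rewrite gt_eqF //; lra.
  by rewrite /x => A; lra.
have A4 : (1 + s) * (L3 - ln 2) <= 2 * s * L3.
  by apply: ler_pM; lra.
lra.
Qed.

(** * Passage to the limit *)

Lemma pow4_expRN_le (R : realType) (x y : R) : 0 < x -> 0 < y ->
  x ^+ 4 * expR (- (y * x)) <= 5`!%:R / y ^+ 5 / x.
Proof.
move=> x0 y0.
have yx0 : 0 < y * x by rewrite mulr_gt0.
have F0 : 0 < 5`!%:R :> R by rewrite ltr0n fact_gt0.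
have := expR_ge_pow 4 (ltW yx0); rewrite ler_pdivrMr //.
rewrite expRN ler_pdivrMr ?expR_gt0 //.
move: (expR _) 5`!%:R => E F H.
rewrite [leRHS](_ : _ = E * F / (y ^+ 5 * x)).
  by rewrite ler_pdivlMr ?mulr_gt0 ?exprn_gt0 // (le_trans _ H) // exprMn; lra.
by field; rewrite !gt_eqF.
Qed.

Lemma lnlnln_ge (R : realType) (B : R) :
  \forall n \near \oo, B <= ln (ln (ln (n%:R : R))).
Proof.
near=> n; do 3!apply: expR_le_ln.
by near: n; exact: nbhs_infty_ger.
Unshelve. all: by end_near. Qed.

Unset Implicit Arguments.

Theorem theorem1p1 (R : realType) (eps : R) (eps_gt0 : 0 < eps) :
  let f (n : nat) : R := ln n%:R / ln (ln (ln n%:R)) in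
  Pr (dtcs R n) (fun t : btree =>
       ((1 - eps) * f n <= (S_ord t)%:R <= (1 + eps) * f n) &&
       ((1 - eps) * f n <= (S_unord t)%:R <= (1 + eps) * f n))
    @[n --> \oo] --> (1 : R).
Proof.
move=> f; apply/cvgrPdist_le => d d0.
pose c : R := 5`!%:R / (eps / 2) ^+ 5.
have c0 : 0 <= c by rewrite divr_ge0 // exprn_ge0 // divr_ge0 // ltW.
(* The sum of the prefactors 576 and [1 + eps] of the two tails. *)
pose C : R := 577 + eps.
have K0 : 0 < 577 :> R by rewrite ltr0n.
have C0 : 0 < C := addr_gt0 K0 eps_gt0.
(* One threshold for [L3]: the first two summands yield the hypotheses of both tail lemmas, the last
   makes the final error [C * c / L] at most [d]. *)
pose B : R := 1 + (2 * ln 16 + 4 * (1 + eps) * ln 2 + 32) / eps +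
  C * c / d.
near=> n.
have : B <= ln (ln (ln (n%:R : R))) by near: n; exact: lnlnln_ge.
rewrite /f; set L := ln (n%:R : R); set L3 := ln (ln L) => BL.
have dP := is_fdist_dtcs R n.
have l16 : 0 <= ln (16 : R) by rewrite ln_ge0 // (ler_nat R 1).
have l2 : 0 <= ln (2 : R) by rewrite ln_ge0 // (ler_nat R 1).
have el2 : 0 <= eps * ln 2 by rewrite mulr_ge0 // ltW.
have Bd : 0 <= C * c / d := divr_ge0 (mulr_ge0 (ltW C0) c0) (ltW d0).
have B1 : 0 <= (2 * ln 16 + 4 * (1 + eps) * ln 2 + 32) / eps.
  by rewrite divr_ge0 //; lra.
have L31 : 1 <= L3 by rewrite (le_trans _ BL) // /B; lra.
have eL3 : 2 * ln 16 + 4 * (1 + eps) * ln 2 + 32 <= eps * L3.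
  by rewrite [leRHS]mulrC -ler_pdivrMr // (le_trans _ BL) // /B; lra.
have L2E : expR L3 = ln L := expR_ln_gt0 (lt_le_trans ltr01 L31).
have L20 : 0 < ln L by rewrite -L2E expR_gt0.
have LE : expR (ln L) = L := expR_ln_gt0 L20.
have L3L : 1 + L3 <= L.
  by rewrite -LE; have := expR_ge1Dx (ln L); have := expR_ge1Dx L3; rewrite L2E; lra.
have dL : C * c / d <= L by rewrite /B in BL; lra.
have low := @lower_tail R n eps eps_gt0 L31.
have upp := @upper_tail R n eps eps_gt0 L31.
rewrite -/L -/L3 in low upp.
have {}low := low ltac:(nra); have {}upp := upp ltac:(nra) ltac:(nra).
have L1 : 1 <= L by lra.
have L0 : 0 < L by lra.
set g := fun t : btree => _ && _.
rewrite ger0_norm; last by rewrite subr_ge0 Pr_le1.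
rewrite -(PrC dP).
have bad t : ~~ g t ->
    ((S_ord t)%:R < (1 - eps) * (L / L3)) || ((1 + eps) * (L / L3) < (S_unord t)%:R).
  apply: contraR; rewrite negb_or -!leNgt => /andP[Hl Hu].
  have Hou : (S_ord t)%:R <= (S_unord t)%:R :> R by rewrite ler_nat S_ord_le_unord.
  by rewrite /g Hl Hu (le_trans Hl) // (le_trans Hou).
apply: le_trans (le_Pr dP bad) _.
apply: le_trans (Pr_or dP _ _) _.
apply: le_trans (lerD low upp) _.
set E := expR _.
have E0 : 0 <= E by exact: expR_ge0.
have L4 : L * E <= L ^+ 4 * E.
  by rewrite ler_wpM2r // exprS ler_peMr ?exprn_ege1 // ltW.
apply: le_trans (_ : C * (L ^+ 4 * E) <= _).
  by have := ler_wpM2l (_ : 0 <= 1 + eps) L4 => /(_ _); rewrite /C; lra.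
have e2 : 0 < eps / 2 by rewrite divr_gt0.
apply: le_trans (ler_wpM2l (ltW C0) (pow4_expRN_le L0 e2)) _.
by rewrite -/c mulrA ler_pdivrMr // [leRHS]mulrC -ler_pdivrMr.
Unshelve. all: by end_near. Qed.
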